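(* Let $f$ be a continuous probability density on $[0,1]^2$ (with respect to Lebesgue measure). Then $$\mathbb{E}\left[\mathrm{LIS}\left(\mathrm{Sample}_N(\mu_f)\right)\right]=\Theta\left(\sqrt{N}\right)\quad\text{as }N\to\infty.$$
   Context: For points $X_1,\dots,X_N\in[0,1]^2$ with pairwise distinct $x$-coordinates and pairwise distinct $y$-coordinates, $\mathrm{Perm}(X_1,\dots,X_N)$ is the permutation $\sigma$ of $\{1,\dots,N\}$ such that $\sigma(i)=j$ whenever the point with $i$-th lowest $x$-coordinate has $j$-th lowest $y$-coordinate. A pre-permuton is a probability measure $\mu$ on $[0,1]^2$ whose two marginals have no atoms. For a pre-permuton $\mu$, $\mathrm{Sample}_N(\mu)$ denotes the random permutation $\mathrm{Perm}(X_1,\dots,X_N)$ where $X_1,\dots,X_N$ are i.i.d. with law $\mu$ (almost surely well defined). For a probability density $f$ on $[0,1]^2$ with respect to Lebesgue measure, $\mu_f$ is the probability measure with density $f$. For a permutation $\sigma$ of size $N$, $\mathrm{LIS}(\sigma)$ is the maximal $k$ such that there exist $i_1<\dots<i_k$ with $\sigma(i_1)<\dots<\sigma(i_k)$. For sequences of positive reals, $a_N=\Theta(b_N)$ means that there are constants $0<c_1\le c_2$ with $c_1b_N\le a_N\le c_2b_N$ for all large enough $N$. *)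

(* Defs.v *)
From HB Require Import structures.
From mathcomp Require Import all_boot all_order all_algebra all_fingroup.
From mathcomp Require Import all_classical all_reals all_analysis.

Set Implicit Arguments.
Unset Strict Implicit.
Unset Printing Implicit Defensive.

Import Order.TTheory GRing.Theory Num.Theory.
Import numFieldNormedType.Exports.

Local Open Scope classical_set_scope.
Local Open Scope ring_scope.

(* R * R with its Borel sigma-algebra, in the form on which the product
   measure [lebesgue_measure \x lebesgue_measure] is defined. *)
Notation plane R := (measurableTypeR R * measurableTypeR R)%type.

Section Permutons.
Context {R : realType}.

Definition unit_square : set (R * R) := `[0, 1] `*` `[0, 1].

Definition lebesgue2 : {measure set (plane R) -> \bar R} :=
  (@lebesgue_measure R \x @lebesgue_measure R)%E.

(* Functions and measures on the unit square are represented on the whole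
   plane; the values of [f] outside the square are irrelevant. *)
Definition probability_density (f : R * R -> R) : Prop :=
  (forall p, unit_square p -> 0 <= f p) /\
  (\int[lebesgue2]_(p in unit_square) (f p)%:E = 1)%E.

Definition mu_ (f : R * R -> R) (A : set (plane R)) : \bar R :=
  (\int[lebesgue2]_(p in unit_square `&` A) (f p)%:E)%E.

(* Since [A k = setT] is allowed, the product rule for the whole family
   contains the product rule for each of its subfamilies. *)
Definition iid_with_law d (Omega : measurableType d) (P : probability Omega R)
    N (mu : set (plane R) -> \bar R) (X : 'I_N -> {RV P >-> plane R}) :
    Prop :=
  (forall A : 'I_N -> set (plane R), (forall k, measurable (A k)) ->
    P [set w | forall k, A k (X k w)] = (\prod_(k < N) P (X k @^-1` A k))%E) /\
  (forall k A, measurable A -> distribution P (X k) A = mu A).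

(* 0-based rank: [rank u k = i] iff [u k] is the (i+1)-th lowest value, when
   the values of [u] are pairwise distinct. *)
Definition rank N (u : 'I_N -> R) (k : 'I_N) : nat :=
  #|[pred j : 'I_N | u j < u k]|.

(* The default value 1 is only used for points sharing a coordinate. *)
Definition perm_of_points N (X : 'I_N -> R * R) : 'S_N :=
  odflt 1%g [pick s : 'S_N | [forall i : 'I_N, forall j : 'I_N,
    [exists k, (rank (fst \o X) k == i) && (rank (snd \o X) k == j)]
      ==> (s i == j)]].

Lemma rank_lt N (u : 'I_N -> R) k : (rank u k < N)%N.
Proof.
rewrite -[X in (_ < X)%N]card_ord; apply: proper_card.
by apply/properP; split; [exact/fintype.subsetP|exists k; rewrite ?inE ?ltxx].
Qed.

Lemma rank_inj N (u : 'I_N -> R) : injective u -> injective (rank u).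
Proof.
move=> ui.
have H a b : u a < u b -> (rank u a < rank u b)%N.
  move=> ab; apply: proper_card; apply/properP; split.
    by apply/fintype.subsetP => j; rewrite !inE => /lt_trans; exact.
  by exists a; rewrite !inE ?ltxx.
by move=> a b ab; apply: ui; case: (ltgtP (u a) (u b)) => // /H; rewrite ab ltnn.
Qed.

Lemma perm_of_pointsE N (X : 'I_N -> R * R) (k : 'I_N) :
  injective (fst \o X) -> injective (snd \o X) ->
  perm_of_points X (Ordinal (rank_lt (fst \o X) k)) =
  Ordinal (rank_lt (snd \o X) k).
Proof.
move=> i1 i2.
set rx := fun k => Ordinal (rank_lt (fst \o X) k).
set ry := fun k => Ordinal (rank_lt (snd \o X) k).
have rxi : injective rx by move=> a b [] /(rank_inj i1).
have ryi : injective ry by move=> a b [] /(rank_inj i2).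
rewrite /perm_of_points; case: pickP => /= [s /forallP/(_ (rx k))|].
  move=> /forallP/(_ (ry k))/implyP H.
  by apply/eqP/H/existsP; exists k; rewrite !eqxx.
move/(_ ((perm.perm rxi)^-1 * perm.perm ryi)%g)/negP; case.
apply/forallP => i; apply/forallP => j; apply/implyP.
move=> /existsP[l /andP[/eqP h1 /eqP h2]].
have -> : i = perm.perm rxi l by rewrite permE; apply: val_inj; rewrite /= -h1.
by rewrite permM permK permE; apply/eqP/val_inj; rewrite /= -h2.
Qed.

Definition LIS N (s : 'S_N) : nat :=
  \max_(k < N.+1 | [exists t : k.-tuple 'I_N,
     sorted ltn [seq val i | i <- t] && sorted ltn [seq val (s i) | i <- t]]) k.

End Permutons.

(* Main.v *)
Require Import Defs.
From HB Require Import structures.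
From mathcomp Require Import all_boot all_order all_algebra all_fingroup.
From mathcomp Require Import all_classical all_reals all_analysis.
From mathcomp Require Import measurable_realfun ring lra.
Import Order.TTheory GRing.Theory Num.Theory.
Import numFieldNormedType.Exports.
Local Open Scope classical_set_scope.
Local Open Scope ring_scope.

(* Upper bound: let M bound f and cut the square into a k x k grid, with k of
   order sqrt(32 M N). An increasing sequence of k sample points visits cells
   whose columns and rows both increase weakly, so a union bound over the
   indices of the points, the columns and the rows gives
   P(LIS >= k) <= N^k 4^k 4^k (M / k^2)^k = (16 M N / k^2)^k <= 2^-k.
   Lower bound: f >= c > 0 on some small square. Cut it into an n x n grid with
   n of order sqrt N. The LIS is at least the number of diagonal cells that
   contain a sample point, and each of them does so with probability bounded
   away from 0. *)

Set Implicit Arguments.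
Unset Strict Implicit.
Unset Printing Implicit Defensive.

(** * Increasing subsequences of the permutation as chains of points *)

Section IncreasingChains.
Context {R : realType}.
Local Open Scope nat_scope.

(** The maximum is attained, and a prefix of an increasing subsequence is increasing, so every
    length up to the maximum occurs. *)
Lemma LIS_geP N (s : 'S_N) k :
  k <= LIS s <-> exists t : k.-tuple 'I_N,
    sorted ltn [seq val i | i <- t] /\ sorted ltn [seq val (s i) | i <- t].
Proof.
split=> [|[t [t1 t2]]]; last first.
  have tU : uniq t.
    by rewrite -(map_inj_uniq val_inj); apply: sorted_uniq t1;
      [exact: ltn_trans|exact: ltnn].
  have kN : k < N.+1.
    by rewrite ltnS -(size_tuple t) -(card_uniqP tU) -[leqRHS]card_ord max_card.
  apply: (@bigop.bigmax_sup _ (Ordinal kN)) => //=.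
  by apply/existsP; exists t; rewrite t1 t2.
have [|m mP mE] := @eq_bigmax_cond _ [pred k : 'I_N.+1 |
    [exists t : k.-tuple 'I_N, sorted ltn [seq val i | i <- t] &&
      sorted ltn [seq val (s i) | i <- t]]] val.
  by apply/card_gt0P; exists ord0; apply/existsP; exists [tuple].
have {mE} -> : LIS s = m by exact: mE.
move: mP => /existsP[t /andP[t1 t2]] km.
have sz : size (take k t) == k by rewrite size_takel// size_tuple.
by exists (Tuple sz); rewrite /= !map_take !take_sorted.
Qed.

(** A chain lists sample indices, whereas an increasing subsequence of the permutation lists
    positions, that is, ranks of x-coordinates. Independence is formulated for sample indices. *)
Definition increasing_chain N (X : 'I_N -> R * R) (t : seq 'I_N) : bool :=
  sorted (relpre (fst \o X) <%R) t && sorted (relpre (snd \o X) <%R) t.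

Lemma rank_ltE N (u : 'I_N -> R) i j : (rank u i < rank u j) = (u i < u j)%R.
Proof.
have H a b : (u a <= u b)%R -> rank u a <= rank u b.
  move=> ab; apply: subset_leq_card; apply/fintype.subsetP => l.
  by rewrite !inE => /lt_le_trans; exact.
case: (ltP (u i) (u j)) => [ij|/H]; last by rewrite ltnNge => ->.
apply: proper_card; apply/properP; split.
  by apply/fintype.subsetP => l; rewrite !inE => /lt_trans; exact.
by exists i; rewrite !inE ?ltxx.
Qed.

(** The x-rank is a bijection from sample indices to positions, and ranks compare as the coordinates
    do. It carries chains to increasing subsequences, and its inverse carries them back. *)
Lemma LIS_perm_of_pointsP N (X : 'I_N -> R * R) k :
  injective (fst \o X) -> injective (snd \o X) ->
  k <= LIS (perm_of_points X) <->
  exists t : k.-tuple 'I_N, increasing_chain X t.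
Proof.
move=> X1 X2.
pose rx i := Ordinal (rank_lt (fst \o X) i).
have rxI : injective rx by move=> a b [] /(rank_inj X1).
have srx i : perm_of_points X (rx i) = Ordinal (rank_lt (snd \o X) i).
  exact: perm_of_pointsE.
rewrite LIS_geP; split=> [[t [t1 t2]]|[t /andP[t1 t2]]].
  exists [tuple of map (invF rxI) t]; rewrite /increasing_chain /= !sorted_map.
  apply/andP; split.
    move: t1; rewrite sorted_map; apply: sub_sorted => i j /=.
    by rewrite -{1}(f_invF rxI i) -{1}(f_invF rxI j) /= rank_ltE.
  move: t2; rewrite sorted_map; apply: sub_sorted => i j /=.
  by rewrite -{1}(f_invF rxI i) -{1}(f_invF rxI j) !srx /= rank_ltE.
exists [tuple of map rx t]; rewrite /= -!map_comp !sorted_map; split.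
  by move: t1; apply: sub_sorted => i j /=; rewrite rank_ltE.
move: t2; apply: sub_sorted => i j; rewrite /relpre /=.
by rewrite !srx /= rank_ltE.
Qed.

Lemma increasing_chain_uniq N (X : 'I_N -> R * R) t :
  increasing_chain X t -> uniq t.
Proof.
move=> /andP[t1 _]; apply: sorted_uniq t1.
- by move=> a b c /=; apply: lt_trans.
- by move=> a /=; rewrite ltxx.
Qed.

Lemma LIS_max N (s : 'S_N) : LIS s <= N.
Proof. by apply/bigmax_leqP => i _; rewrite -ltnS. Qed.

End IncreasingChains.

(** * Union bound, and expectations bounded through indicators *)

Section MeasureBounds.
Context {R : realType}.
Local Open Scope ereal_scope.

(* The integral of a nonnegative function is a supremum over the simple
   functions below it, hence monotone even for non-measurable functions; this
   spares a proof that the LIS and [f] are measurable. *)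
Lemma ge0_le_integral_restrict d (T : measurableType d)
    (mu : {measure set T -> \bar R}) (D E : set T) (f g : T -> \bar R) :
  (forall x, D x -> 0 <= f x) -> (forall x, E x -> 0 <= g x) ->
  (forall x, (f \_ D) x <= (g \_ E) x) ->
  \int[mu]_(x in D) f x <= \int[mu]_(x in E) g x.
Proof.
move=> f0 g0 fg; rewrite !ge0_integralE//; apply: ereal_sup_le.
by move=> _ [h /= hf <-]; exists h => // x; exact: le_trans (hf x) (fg x).
Qed.

Context d (T : measurableType d) (P : probability T R).

Lemma measure_bigcup_fin_le (I : finType) (A : I -> set T) :
  (forall i, measurable (A i)) ->
  P (\bigcup_(i in [set: I]) A i) <= \sum_(i : I) P (A i).
Proof.
move=> mA; have -> : [set: I] = [set` enum I].
  by apply/seteqP; split => // i _ /=; rewrite mem_enum.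
rewrite bigcup_seq -[X in _ <= X]big_enum /=.
elim: (enum I) => [|i s IH]; first by rewrite !big_nil measure0.
rewrite !big_cons; apply: le_trans (measureU2 _ _ _) _ => //.
  exact: bigsetU_measurable.
by rewrite leeD2l.
Qed.

Lemma expectation_ge_sum_indic n (Y : T -> R) (A : 'I_n -> set T) :
  (forall i, measurable (A i)) ->
  (forall w, \sum_(i < n) \1_(A i) w <= Y w)%R ->
  \sum_(i < n) P (A i) <= 'E_P[Y].
Proof.
move=> mA AY; rewrite expectation.unlock.
have -> : \sum_(i < n) P (A i) = \sum_(i < n) \int[P]_w (\1_(A i) w)%:E.
  by apply: eq_bigr => i _; rewrite integral_indic// setIT.
rewrite -ge0_integral_sum//; last by move=> i; exact/measurable_EFinP.
have A0 w : (0 <= \sum_(i < n) \1_(A i) w :> R)%R by apply: sumr_ge0.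
apply: ge0_le_integral_restrict => w; rewrite ?patch_setT ?lee_fin.
- by move=> _; exact: sume_ge0.
- by move=> _; exact: le_trans (A0 w) (AY w).
- by rewrite sumEFin lee_fin.
Qed.

Lemma expectation_le_indic (Y : T -> R) (A : set T) (a b : R) :
  measurable A -> (0 <= a)%R -> (0 <= b)%R ->
  (forall w, 0 <= Y w <= a + b * \1_A w)%R ->
  'E_P[Y] <= a%:E + b%:E * P A.
Proof.
move=> mA a0 b0 Yab; rewrite expectation.unlock.
have -> : a%:E + b%:E * P A = \int[P]_w (a%:E + b%:E * (\1_A w)%:E).
  rewrite ge0_integralD//.
  - rewrite integral_cst// [X in _ * X + _](_ : _ = 1); last first.
      exact: probability_setT.
    rewrite mule1 ge0_integralZl//.
    + by rewrite integral_indic// setIT.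
    + exact/measurable_EFinP.
  - by move=> w _; rewrite -EFinM lee_fin mulr_ge0.
  - by apply/measurable_EFinP/measurable_funM.
apply: ge0_le_integral_restrict => w;
  rewrite ?patch_setT -?EFinM -?EFinD ?lee_fin.
- by have /andP[] := Yab w.
- by rewrite addr_ge0 ?mulr_ge0.
- by have /andP[] := Yab w.
Qed.

End MeasureBounds.

(** * Rectangles under the density: upper and lower mass bounds *)

Section Density.
Context {R : realType} (f : R * R -> R).

Lemma lebesgue2_itv (i j : interval R) :
  lebesgue2 ([set` i] `*` [set` j]) =
  (lebesgue_measure [set` i] * lebesgue_measure [set` j])%E.
Proof. by apply: product_measure1E. Qed.

Lemma lebesgue2_square (a b h : R) (s t : bool) : 0 < h ->
  lebesgue2 ([set` Interval (BSide s a) (BSide t (a + h))] `*`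
             [set` Interval (BSide s b) (BSide t (b + h))]) = (h ^+ 2)%:E.
Proof.
move=> h0; rewrite lebesgue2_itv !lebesgue_measure_itv /= !lte_fin.
by rewrite !ltrDl h0 -!EFinB -EFinM; congr EFin; ring.
Qed.

(** Only the part of [A] inside the square has mass, so [A] may be an unbounded slab of the grid
    while [B] is a true rectangle of known area. *)
Lemma mu_le_cst (M : R) (A B : set (plane R)) :
  (forall p, unit_square p -> 0 <= f p <= M) -> 0 <= M ->
  measurable B -> unit_square `&` A `<=` B ->
  (mu_ f A <= M%:E * lebesgue2 B)%E.
Proof.
move=> fM M0 mB AB; rewrite -integral_cst//.
apply: ge0_le_integral_restrict.
- by move=> p [/fM/andP[f0 _] _]; rewrite lee_fin.
- by move=> p _; rewrite lee_fin.
- move=> p; rewrite /patch; case: ifPn => [|_].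
    rewrite inE => Ap; have /fM/andP[_ fpM] := Ap.1.
    by rewrite mem_set ?lee_fin//; apply: AB.
  by case: ifPn => //; rewrite lee_fin.
Qed.

Lemma mu_ge_cst (c : R) (A B : set (plane R)) :
  (forall p, unit_square p -> 0 <= f p) -> 0 <= c ->
  measurable B -> B `<=` unit_square `&` A -> (forall p, B p -> c <= f p) ->
  (c%:E * lebesgue2 B <= mu_ f A)%E.
Proof.
move=> f0 c0 mB BA cf; rewrite -integral_cst//.
apply: ge0_le_integral_restrict.
- by move=> p _; rewrite lee_fin.
- by move=> p [/f0 fp0 _]; rewrite lee_fin.
- move=> p; rewrite /patch; case: ifPn => [|_].
    by rewrite inE => Bp; rewrite mem_set ?lee_fin ?cf//; apply: BA.
  by case: ifPn => //; rewrite inE => -[/f0]; rewrite lee_fin.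
Qed.

Hypothesis f_continuous : {within unit_square, continuous f}.
Hypothesis f_density : probability_density f.

(** Continuity on a compact set. The normalisation [1 <= M] later makes [Num.sqrt (32 * M)] at least
    1. *)
Lemma density_bounded : exists2 M : R, 1 <= M &
  forall p, unit_square p -> 0 <= f p <= M.
Proof.
have [f0 _] := f_density.
have /compact_bounded : compact (f @` unit_square).
  apply: continuous_compact => //.
  by apply: compact_setX; exact: segment_compact.
move=> [B [_ HB]]; exists (Num.max 1 (B + 1)); first by rewrite le_max lexx.
move=> p sp; rewrite f0//=; apply: le_trans (ler_norm _) _.
apply: HB; last by exists p.
by rewrite lt_max ltrDl ltr01 orbT.
Qed.

(** A density with integral 1 is positive at some [p0], and by continuity it exceeds [f p0 / 2] on
    the part of the unit square near [p0]. *)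
Lemma density_pos_square : exists c h a b : R,
  [/\ 0 < c, 0 < h, `[a, a + h] `*` `[b, b + h] `<=` unit_square &
      forall p, (`[a, a + h] `*` `[b, b + h]) p -> c <= f p].
Proof.
have [f0 f1] := f_density.
have [p0 [sp0 fp0]] : exists p, unit_square p /\ 0 < f p.
  apply/not_existsP => H; move: f1; rewrite integral0_eq.
    by move/esym/eqP; rewrite onee_eq0.
  move=> p sp; congr EFin; apply/eqP; rewrite eq_le f0// andbT leNgt.
  by apply/negP => fp; apply: (H p).
have : \forall p \near within unit_square (nbhs p0), f p0 / 2 < f p.
  have /subspace_continuousP/(_ p0 sp0)/cvgr_gt := f_continuous.
  by apply; rewrite ltr_pdivrMr// ltr_pMr// ltr1n.
rewrite /within/= => /nbhs_ballP[e /= e0 He].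
pose h := Num.min 2^-1 (e / 2).
have h0 : 0 < h by rewrite lt_min invr_gt0 ltr0n divr_gt0.
have h2 : h <= 2^-1 by rewrite ge_min lexx.
have he : h < e by rewrite gt_min ltr_pdivrMr// ltr_pMr// ltr1n orbT.
(* As [p0] may lie on the boundary, it is taken as a corner of the small square: each side extends
   to the right of [u] if [u <= 2^-1] and to the left otherwise. The bound [h <= 2^-1] leaves enough
   room. *)
have seg (u : R) : u \in `[0, 1] -> exists a : R, forall x, x \in `[a, a + h] ->
    0 <= x <= 1 /\ `|u - x| < e.
  rewrite in_itv /= => /andP[u0 u1].
  exists (if u <= 2^-1 then u else u - h) => x; rewrite in_itv /=.
  rewrite ltr_norml; case: ifPn => [u2 /andP[xl xr]|].
    by split; lra.
  by rewrite -ltNge => u2 /andP[xl xr]; split; lra.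
have [a Ha] := seg _ sp0.1; have [b Hb] := seg _ sp0.2.
have sub : `[a, a + h] `*` `[b, b + h] `<=` unit_square.
  by move=> p [/Ha[p1 _] /Hb[p2 _]]; split; rewrite /= in_itv.
exists (f p0 / 2), h, a, b; split => //; first by rewrite divr_gt0.
move=> p pab; apply/ltW/He; last exact: sub.
by case: pab => /Ha[_ p1] /Hb[_ p2]; split.
Qed.

End Density.

(** * Grid cells, independence, and almost sure distinctness of coordinates *)

Section Grid.
Context {R : realType}.

(* Everything outside the unit interval is added, so that every real lies in
   one of the [n] slabs; this does not change the [mu_ f]-mass. *)
Definition slab (n a : nat) : set R :=
  ~` `[0, 1] `|` `[a%:R / n%:R, a%:R / n%:R + n%:R^-1].

(** The cap at [n.-1] puts the point 1 into the last slab. The resulting index is weakly monotone on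
    the whole line. *)
Definition column (n : nat) (x : R) : nat :=
  minn (Num.truncn (n%:R * x)) n.-1.

Lemma measurable_slab n a : measurable (slab n a).
Proof. by apply: measurableU; [exact: measurableC|]. Qed.

Lemma slab_column n x : (0 < n)%N -> slab n (column n x) x.
Proof.
move=> n0; have n0' : 0 < n%:R :> R by rewrite ltr0n.
case: (boolP (x \in `[0, 1])) => [|/negP]; last by left.
rewrite in_itv /= => /andP[x0 x1]; right.
rewrite /= in_itv /= -[X in _ + X]mul1r -mulrDl ler_pdivrMr// ler_pdivlMr// natr1.
have nx0 : 0 <= n%:R * x by rewrite mulr_ge0// ltW.
have /andP[h1 h2] := truncn_itv nx0.
rewrite [x * _]mulrC /column; apply/andP; split.
  by apply: le_trans h1; rewrite ler_nat geq_minl.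
rewrite /minn; case: ifP => _; first exact: ltW.
by rewrite prednK// ler_piMr// ltW.
Qed.

Lemma column_lt n x : (0 < n)%N -> (column n x < n)%N.
Proof. by case: n => // n _; rewrite ltnS geq_minr. Qed.

Lemma le_column n x y : x <= y -> (column n x <= column n y)%N.
Proof.
move=> xy; rewrite leq_min geq_minr andbT; apply: leq_trans (geq_minl _ _) _.
by apply: le_truncn; rewrite ler_wpM2l.
Qed.

Context (f : R * R -> R) (M : R).
Hypothesis M_ge0 : 0 <= M.
Hypothesis f_bounded : forall p, unit_square p -> 0 <= f p <= M.

Lemma mu_cell_le n a b : (0 < n)%N ->
  (mu_ f (slab n a `*` slab n b) <= (M / n%:R ^+ 2)%:E)%E.
Proof.
move=> n0; have n0' : 0 < n%:R^-1 :> R by rewrite invr_gt0 ltr0n.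
rewrite -exprVn EFinM.
rewrite -(lebesgue2_square (a%:R / n%:R) (b%:R / n%:R) true false n0').
apply: (mu_le_cst f_bounded M_ge0).
  by apply: measurableX.
by move=> p [[p1 p2] [/= [] // q1 [] // q2]].
Qed.

(** Constraining one coordinate only, this estimate and its horizontal analogue quantify that the
    marginals have no atoms. *)
Lemma mu_vslab_le n a : (0 < n)%N ->
  (mu_ f (fst @^-1` slab n a) <= (M / n%:R)%:E)%E.
Proof.
move=> n0; have n0' : 0 < n%:R^-1 :> R by rewrite invr_gt0 ltr0n.
have -> : (M / n%:R)%:E = (M%:E * lebesgue2
    (`[(a%:R / n%:R)%R, (a%:R / n%:R + n%:R^-1)%R] `*` `[0%R, 1%R]))%E.
  rewrite lebesgue2_itv !lebesgue_measure_itv /= !lte_fin.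
  by rewrite !ltrDl n0' ltr01 -!EFinB -!EFinM; congr EFin; ring.
apply: (mu_le_cst f_bounded M_ge0).
  by apply: measurableX.
by move=> p [[p1 p2]] [] // q1.
Qed.

Lemma mu_hslab_le n a : (0 < n)%N ->
  (mu_ f (snd @^-1` slab n a) <= (M / n%:R)%:E)%E.
Proof.
move=> n0; have n0' : 0 < n%:R^-1 :> R by rewrite invr_gt0 ltr0n.
have -> : (M / n%:R)%:E = (M%:E * lebesgue2
    (`[0%R, 1%R] `*` `[(a%:R / n%:R)%R, (a%:R / n%:R + n%:R^-1)%R]))%E.
  rewrite lebesgue2_itv !lebesgue_measure_itv /= !lte_fin.
  by rewrite !ltrDl n0' ltr01 -!EFinB -!EFinM; congr EFin; ring.
apply: (mu_le_cst f_bounded M_ge0).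
  by apply: measurableX.
by move=> p [[p1 p2]] [] // q1.
Qed.

Context d (Omega : measurableType d) (P : probability Omega R) (N : nat).
Context (X : 'I_N -> {RV P >-> plane R}).
Hypothesis X_iid : iid_with_law (mu_ f) X.

Lemma measurable_joint (S : pred 'I_N) (A : 'I_N -> set (plane R)) :
  (forall i, measurable (A i)) ->
  measurable [set w | forall i, S i -> A i (X i w)].
Proof.
move=> mA.
have -> : [set w | forall i, S i -> A i (X i w)] =
    \bigcap_(i in [set` S]) (X i @^-1` A i) by [].
by apply: fin_bigcap_measurable => // i _; exact: measurable_funPTI.
Qed.

Lemma law_preimage i A : measurable A -> P (X i @^-1` A) = mu_ f A.
Proof. by move=> mA; have [_ /(_ i A mA)] := X_iid. Qed.

(** The product rule is applied with [setT] at the indices outside [S], whose factors are at most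
    1. *)
Lemma joint_le (S : pred 'I_N) (A : 'I_N -> set (plane R)) (q : R) :
  (forall i, measurable (A i)) ->
  (forall i, (P (X i @^-1` A i) <= q%:E)%E) ->
  (P [set w | forall i, S i -> A i (X i w)] <= (q ^+ #|S|)%:E)%E.
Proof.
move=> mA Aq; have [Xprod _] := X_iid.
pose B i := if S i then A i else setT.
have mB i : measurable (B i) by rewrite /B; case: ifP.
have -> : [set w | forall i, S i -> A i (X i w)] =
    [set w | forall i, B i (X i w)].
  apply/seteqP; split => w /= H i; rewrite /B; first by case: ifPn => // /H.
  by move=> Si; have := H i; rewrite /B Si.
rewrite Xprod//.
have PB i : P (X i @^-1` B i) = (fine (P (X i @^-1` B i)))%:E.
  by rewrite fineK// fin_num_measure//; exact: measurable_funPTI.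
under eq_bigr do rewrite PB.
rewrite prodEFin lee_fin -prodr_const [leRHS]big_mkcond /=.
apply: ler_prod => i _; rewrite fine_ge0//=.
rewrite -lee_fin -PB unfold_in /B; case: ifPn => Si; first exact: Aq.
by rewrite preimage_setT; apply: probability_le1.
Qed.

Lemma measurable_coincide (g : plane R -> R) (i j : 'I_N) :
  measurable_fun setT g -> measurable [set w | g (X i w) = g (X j w)].
Proof.
move=> mg; have -> : [set w | g (X i w) = g (X j w)] =
    (fun w => g (X i w) - g (X j w)) @^-1` [set 0].
  apply/seteqP; split => w /= => [->|/eqP]; first by rewrite subrr.
  by rewrite subr_eq0 => /eqP.
rewrite -[X in measurable X]setTI.
by apply: measurable_funB => //; apply: measurableT_comp => //.
Qed.

(** Two points with equal values of [g] share one of [n] slabs. By independence this has probability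
    at most [n * (M / n) ^ 2 = M ^ 2 / n], for every positive [n]. *)
Lemma coincide_null (g : plane R -> R) (i j : 'I_N) :
  measurable_fun setT g ->
  (forall n a, (0 < n)%N -> (mu_ f (g @^-1` slab n a) <= (M / n%:R)%:E)%E) ->
  i != j -> P [set w | g (X i w) = g (X j w)] = 0%E.
Proof.
move=> mg gM ij.
pose E := [set w | g (X i w) = g (X j w)].
have mE : measurable E by exact: measurable_coincide.
have bound n : (0 < n)%N -> (P E <= (M ^+ 2 / n%:R)%:E)%E.
  move=> n0.
  pose F (a : 'I_n) :=
    [set w | forall k, pred2 i j k -> (g @^-1` slab n a) (X k w)].
  have mgs a : measurable (g @^-1` slab n a).
    rewrite -[X in measurable X]setTI.
    by apply: mg => //; exact: measurable_slab.
  have mF a : measurable (F a).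
    exact: (measurable_joint (pred2 i j) (fun=> mgs a)).
  have EF : E `<=` \bigcup_(a in [set: 'I_n]) F a.
    move=> w Ew; exists (Ordinal (column_lt (g (X i w)) n0)) => //.
    by move=> k /pred2P[] -> /=; rewrite -?Ew; exact: slab_column.
  apply: le_trans (le_measure P _ _ EF) _; rewrite ?inE//.
    exact: fin_bigcup_measurable.
  apply: le_trans (measure_bigcup_fin_le P mF) _.
  apply: (@le_trans _ _ (\sum_(a < n) ((M / n%:R) ^+ 2)%:E)%E).
    apply: lee_sum => a _; have -> : 2%N = #|pred2 i j| by rewrite card2 ij.
    apply: (@joint_le (pred2 i j) (fun=> g @^-1` slab n a)) => // k.
    by rewrite law_preimage//; exact: gM.
  rewrite sumEFin lee_fin sumr_const card_ord -[leLHS]mulr_natr.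
  rewrite expr_div_n -mulrA ler_wpM2l ?exprn_ge0//.
  by rewrite expr2 invfM mulfVK ?pnatr_eq0 -?lt0n.
apply/eqP; rewrite eq_le measure_ge0 andbT; apply/lee_addgt0Pr => e e0.
rewrite add0e; pose n := (Num.truncn (M ^+ 2 / e)).+1.
apply: le_trans (bound n isT) _; rewrite lee_fin ler_pdivrMr ?ltr0n// mulrC.
by rewrite -ler_pdivrMr//; exact/ltW/truncnS_gt.
Qed.

(** A finite union of null coincidence events, one for each coordinate and each pair of distinct
    indices. Outside it, chains of points determine the LIS. *)
Lemma coordinates_distinct : exists C : set Omega,
  [/\ measurable C, P C = 0%E & forall w, ~ C w ->
    injective (fun k => (X k w).1) /\ injective (fun k => (X k w).2)].
Proof.
pose E (g : plane R -> R) (ij : 'I_N * 'I_N) :=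
  if ij.1 == ij.2 then set0 else [set w | g (X ij.1 w) = g (X ij.2 w)].
have mE g ij : measurable_fun setT g -> measurable (E g ij).
  by move=> mg; rewrite /E; case: ifP => _; [|exact: measurable_coincide].
have m1 : measurable_fun setT (fst : plane R -> R) by exact: measurable_fst.
have m2 : measurable_fun setT (snd : plane R -> R) by exact: measurable_snd.
pose F ij := E fst ij `|` E snd ij.
have mF ij : measurable (F ij) by apply: measurableU; exact: mE.
have EN g w : ~ (exists ij, E g ij w) -> injective (fun k => g (X k w)).
  move=> H i j gij; apply/eqP; apply: contrapT => /negP ij; apply: H.
  by exists (i, j); rewrite /E /= (negbTE ij).
exists (\bigcup_(ij in [set: 'I_N * 'I_N]) F ij); split.
- exact: fin_bigcup_measurable.
- apply/eqP; rewrite eq_le measure_ge0 andbT.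
  apply: le_trans (measure_bigcup_fin_le P mF) _.
  rewrite big1// => ij _; apply/eqP; rewrite eq_le measure_ge0 andbT.
  apply: le_trans (measureU2 _ _ _) _; [exact: mE|exact: mE|].
  rewrite /E; case: ifPn => ij12; first by rewrite measure0 adde0.
  apply: (@le_trans _ _ (0 + 0)%E); last by rewrite adde0.
  apply: leeD.
    by have /= -> := coincide_null m1 mu_vslab_le ij12.
  by have /= -> := coincide_null m2 mu_hslab_le ij12.
- move=> w Cw; split.
    by apply: (EN fst) => -[ij ijw]; apply: Cw; exists ij => //; left.
  by apply: (EN snd) => -[ij ijw]; apply: Cw; exists ij => //; right.
Qed.

End Grid.

(** * Upper bound: counting the possible chains *)

Lemma bin_le_exp2 n m : ('C(n, m) <= 2 ^ n)%N.
Proof.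
elim: n m => [|n IH] [|m]; rewrite ?bin0 ?expn_gt0//.
by rewrite binS expnS mul2n -addnn leq_add.
Qed.

Section UpperBound.
Context {R : realType} (f : R * R -> R) (M : R).
Hypothesis M_ge0 : 0 <= M.
Hypothesis f_bounded : forall p, unit_square p -> 0 <= f p <= M.
Context d (Omega : measurableType d) (P : probability Omega R) (N : nat).
Context (X : 'I_N -> {RV P >-> plane R}).
Hypothesis X_iid : iid_with_law (mu_ f) X.

(* A chain of [k] points in a [k * k] grid is encoded by its indices [t] and by
   the weakly increasing sequences [a] and [b] of its columns and rows. *)
Lemma increasing_chain_unlikely k : (0 < k)%N -> exists B : set Omega,
  [/\ measurable B,
      (P B <= ((16 * M * N%:R / k%:R ^+ 2) ^+ k)%:E)%E &
      forall w (t : k.-tuple 'I_N),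
        increasing_chain (fun i => X i w) t -> B w].
Proof.
(* The successor form provides [ord0], the default of [nth] below; the default only affects indices
   outside the tuple, which [F] leaves unconstrained. *)
case: k => // k' _; set k := k'.+1.
have k0 : 0 < k%:R :> R by rewrite ltr0n.
pose q := M / k%:R ^+ 2.
have q0 : 0 <= q by rewrite divr_ge0// exprn_ge0// ltW.
pose A (u : k.-tuple 'I_N * (k.-tuple 'I_k * k.-tuple 'I_k)) (i : 'I_N) :=
  slab k (nth ord0 u.2.1 (index i u.1)) `*`
  slab k (nth ord0 u.2.2 (index i u.1)) : set (plane R).
have mA u i : measurable (A u i).
  by apply: measurableX; exact: measurable_slab.
pose S := [set t : k.-tuple 'I_k | sorted leq (map val t)]%SET.
pose D := finset.setX [set: k.-tuple 'I_N]%SET (finset.setX S S).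
(* Without repetitions, [k] distinct independent points are constrained, so that the exponent of [q]
   is exactly [k]. *)
pose F u := if (u \in D) && uniq u.1
  then [set w | forall i, i \in u.1 -> A u i (X i w)] else set0.
have mF u : measurable (F u).
  rewrite /F; case: ifP => // _.
  exact: (measurable_joint X (fun i => i \in u.1) (mA u)).
exists (\bigcup_(u in [set: _]) F u); split.
- exact: fin_bigcup_measurable.
- apply: le_trans (measure_bigcup_fin_le P mF) _.
  apply: (@le_trans _ _ (\sum_(u in D) (q ^+ k)%:E)%E).
    rewrite [leRHS]big_mkcond /=; apply: lee_sum => u _; rewrite /F.
    case: ifPn => [/andP[-> uU]|_]; last first.
      by rewrite measure0; case: ifP; rewrite // lee_fin exprn_ge0.
    rewrite -[X in _ ^+ X](size_tuple u.1) -(card_uniqP uU).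
    apply: (joint_le X_iid (fun i => i \in u.1) (mA u)) => i.
    by rewrite (law_preimage X_iid)//; exact: mu_cell_le.
  rewrite sumEFin lee_fin sumr_const !cardsX cardsT card_tuple card_ord.
  rewrite -[leLHS]mulr_natr.
  have -> : 16 * M * N%:R / k%:R ^+ 2 = q * (N * 16)%:R.
    by rewrite /q natrM; ring.
  rewrite [leRHS]exprMn ler_wpM2l ?exprn_ge0// -natrX ler_nat expnMn leq_mul//.
  (* There are ['C(k + k', k)] weakly increasing sequences of columns, with [k + k' = 2k - 1], hence
     at most [4 ^ k]; likewise for the rows. *)
  rewrite card_sorted_tuples -[16%N]/(4 * 4)%N expnMn.
  have H : ('C(k + k', k) <= 4 ^ k)%N.
    apply: leq_trans (bin_le_exp2 _ _) _; rewrite -[4%N]/(2 ^ 2)%N -expnM.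
    by rewrite leq_exp2l// mul2n -addnn leq_add2l.
  exact: leq_mul.
- move=> w t tX.
  pose a := map_tuple (fun i => inord (column k (X i w).1) : 'I_k) t.
  pose b := map_tuple (fun i => inord (column k (X i w).2) : 'I_k) t.
  have vc x : val (inord (column k x) : 'I_k) = column k x :> nat.
    by rewrite /= inordK// column_lt.
  exists (t, (a, b)) => //; rewrite /F.
  have -> : (t, (a, b)) \in D.
    move: tX => /andP[t1 t2].
    rewrite !inE /= -!map_comp !sorted_map; apply/andP; split.
      by apply: sub_sorted t1 => i j /= /ltW ij; rewrite !vc le_column.
    by apply: sub_sorted t2 => i j /= /ltW ij; rewrite !vc le_column.
  rewrite (increasing_chain_uniq tX) /= => i it.
  split; rewrite /= (nth_map i) ?index_mem// nth_index// vc; exact: slab_column.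
Qed.

(** Off the exceptional event the LIS is at most [k], and on it at most [N]. The condition on [k]
    makes the base of the power at most [2^-1], so the event has probability at most
    [2^-1 ^ k <= k^-1]. *)
Lemma LIS_expectation_le k : (0 < k)%N -> 32 * M * N%:R <= k%:R ^+ 2 ->
  ('E_P[fun w => (LIS (perm_of_points (fun i => X i w)))%:R]
     <= (k%:R + N%:R / k%:R)%:E)%E.
Proof.
move=> k0 Mk; have k0' : 0 < k%:R :> R by rewrite ltr0n.
have [B [mB PB chainB]] := increasing_chain_unlikely k0.
have [C [mC PC distC]] := coordinates_distinct M_ge0 f_bounded X_iid.
have mBC : measurable (B `|` C) by exact: measurableU.
apply: le_trans (@expectation_le_indic _ _ _ P _ _ k%:R N%:R mBC _ _ _) _ => //.
  move=> w; rewrite ler0n /=; case: (pselect ((B `|` C) w)) => [BCw|BCw].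
    rewrite indicE mem_set// mulr1 -natrD ler_nat.
    by rewrite (leq_trans (LIS_max _))// leq_addl.
  rewrite indicE memNset// mulr0 addr0 ler_nat leqNgt; apply/negP => kL.
  have [X1 X2] :
      injective (fun i => (X i w).1) /\ injective (fun i => (X i w).2).
    by apply: distC => Cw; apply: BCw; right.
  have [t tX] := (LIS_perm_of_pointsP k X1 X2).1 (ltnW kL).
  by apply: BCw; left; exact: chainB tX.
rewrite EFinD leeD2l// EFinM lee_wpmul2l ?lee_fin//.
apply: (@le_trans _ _ (P B)); first by rewrite -[leRHS]adde0 -PC measureU2.
apply: le_trans PB _; rewrite lee_fin.
apply: (@le_trans _ _ (2^-1 ^+ k)).
  rewrite lerXn2r ?nnegrE ?invr_ge0//.
    by rewrite divr_ge0 ?mulr_ge0// exprn_ge0// ltW.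
  by rewrite ler_pdivrMr ?exprn_gt0//; lra.
rewrite exprVn lef_pV2 ?posrE ?exprn_gt0//.
by rewrite -natrX ler_nat ltnW// ltn_expl.
Qed.

End UpperBound.

(** * Lower bound: occupied cells on a diagonal *)

Section LowerBound.
Context {R : realType} (f : R * R -> R) (M c h a b : R).
Hypothesis M_ge0 : 0 <= M.
Hypothesis f_bounded : forall p, unit_square p -> 0 <= f p <= M.
Hypotheses (c_gt0 : 0 < c) (h_gt0 : 0 < h).
Hypothesis square_sub : `[a, a + h] `*` `[b, b + h] `<=` unit_square.
Hypothesis f_ge : forall p, (`[a, a + h] `*` `[b, b + h]) p -> c <= f p.
Context d (Omega : measurableType d) (P : probability Omega R) (N : nat).
Context (X : 'I_N -> {RV P >-> plane R}).
Hypothesis X_iid : iid_with_law (mu_ f) X.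

(** Half-open intervals make both coordinates strictly larger in a later cell. *)
Definition diagonal_cell (n m : nat) : set (plane R) :=
  `[a + m%:R * (h / n%:R), a + m%:R * (h / n%:R) + h / n%:R[ `*`
  `[b + m%:R * (h / n%:R), b + m%:R * (h / n%:R) + h / n%:R[.

Lemma measurable_diagonal_cell n m : measurable (diagonal_cell n m).
Proof. by apply: measurableX. Qed.

Lemma mu_diagonal_cell_ge n m : (m < n)%N ->
  ((c * (h / n%:R) ^+ 2)%:E <= mu_ f (diagonal_cell n m))%E.
Proof.
move=> mn; have n0 : 0 < n%:R :> R by rewrite ltr0n (leq_ltn_trans _ mn).
have hn : 0 < h / n%:R by rewrite divr_gt0.
have mh : m%:R * (h / n%:R) + h / n%:R <= h.
  rewrite -[X in _ + X]mul1r -mulrDl natr1 mulrCA ger_pMr// ler_pdivrMr// mul1r.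
  by rewrite ler_nat.
have m0 : 0 <= m%:R * (h / n%:R) by rewrite mulr_ge0// ltW.
have sub : diagonal_cell n m `<=` `[a, a + h] `*` `[b, b + h].
  move=> p [] /=; rewrite !in_itv /= => /andP[? ?] /andP[? ?].
  by split; apply/andP; split; lra.
rewrite EFinM -(lebesgue2_square (a + m%:R * (h / n%:R))
                                 (b + m%:R * (h / n%:R)) true true hn).
apply: mu_ge_cst => //.
- by move=> p /f_bounded/andP[].
- exact: ltW.
- exact: measurable_diagonal_cell.
- by move=> p Dp; split => //; apply/square_sub/sub.
- by move=> p /sub/f_ge.
Qed.

Lemma diagonal_cell_lt n m1 m2 (p1 p2 : R * R) : (m1 < m2)%N ->
  diagonal_cell n m1 p1 -> diagonal_cell n m2 p2 -> p1.1 < p2.1 /\ p1.2 < p2.2.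
Proof.
move=> m12 [/=]; rewrite !in_itv /= => /andP[_ p11] /andP[_ p12].
move=> [/=]; rewrite !in_itv /= => /andP[p21 _] /andP[p22 _].
have hm : m1%:R * (h / n%:R) + h / n%:R <= m2%:R * (h / n%:R).
  rewrite -[X in _ + X]mul1r -mulrDl natr1 ler_wpM2r ?ler_nat//.
  by rewrite divr_ge0// ltW.
by split; lra.
Qed.

Definition occupied n m : set Omega :=
  [set w | exists i, diagonal_cell n m (X i w)].

Lemma occupied_setC n m :
  ~` occupied n m =
  [set w | forall i : 'I_N, predT i -> (~` diagonal_cell n m) (X i w)].
Proof.
apply/seteqP; split => [w H i _ iD|w H [i]]; last exact: H.
by apply: H; exists i.
Qed.

Lemma measurable_occupied n m : measurable (occupied n m).
Proof.
rewrite -[occupied n m]setCK occupied_setC; apply: measurableC.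
apply: (measurable_joint X predT (A := fun=> ~` diagonal_cell n m)) => i.
by apply: measurableC; exact: measurable_diagonal_cell.
Qed.

(** By independence the cell is missed by all [N] points with probability at most [(1 - x) ^ N],
    where [x = c * (h / n) ^ 2], and [1 - x <= expR (- x)]. *)
Lemma occupied_ge n m : (m < n)%N ->
  ((1 - expR (- (c * (h / n%:R) ^+ 2)) ^+ N)%:E <= P (occupied n m))%E.
Proof.
move=> mn; have mO := measurable_occupied n m.
have mD := measurable_diagonal_cell n m.
rewrite -[occupied n m]setCK probability_setC; last exact: measurableC.
rewrite EFinB leeB// occupied_setC -[X in _ ^+ X](card_ord N).
apply: (joint_le X_iid predT (A := fun=> ~` diagonal_cell n m)) => i.
  exact: measurableC.
rewrite -preimage_setC probability_setC; last exact: measurable_funPTI.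
apply: le_trans (_ : ((1 - c * (h / n%:R) ^+ 2)%:E <= _)%E).
  by rewrite EFinB leeB// (law_preimage X_iid)// mu_diagonal_cell_ge.
by rewrite lee_fin expR_ge1Dx.
Qed.

(** One point chosen in each occupied cell, in the order of the cells, gives a chain. *)
Lemma LIS_ge_occupied n w : (0 < N)%N ->
  injective (fun i => (X i w).1) -> injective (fun i => (X i w).2) ->
  (#|[pred m : 'I_n | `[< occupied n m w >]]| <=
     LIS (perm_of_points (fun i => X i w)))%N.
Proof.
move=> N0 X1 X2.
have /choice[i Hi] (m : 'I_n) :
    exists i, occupied n m w -> diagonal_cell n m (X i w).
  case: (pselect (occupied n m w)) => [[i Di]|nO]; first by exists i.
  (* An arbitrary index for an empty cell; the filter defining [s] discards it. *)
  by exists (Ordinal N0).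
pose s := [seq m : 'I_n <- enum 'I_n | `[< occupied n m w >]].
have -> : #|[pred m : 'I_n | `[< occupied n m w >]]| = size (map i s).
  by rewrite size_map cardE /s enumT; congr size; apply: eq_filter.
apply/LIS_perm_of_pointsP => //; exists (in_tuple (map i s)).
have sO : all (fun m : 'I_n => `[< occupied n m w >]) s by rewrite filter_all.
have s_sorted : sorted (relpre val ltn) s.
  apply: sorted_filter; first by move=> ? ? ? /=; exact: ltn_trans.
  by rewrite -sorted_map val_enum_ord iota_ltn_sorted.
rewrite /increasing_chain /= !sorted_map.
have H (m1 m2 : 'I_n) : `[< occupied n m1 w >] -> `[< occupied n m2 w >] ->
    (m1 < m2)%N ->
    (X (i m1) w).1 < (X (i m2) w).1 /\ (X (i m1) w).2 < (X (i m2) w).2.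
  move=> /asboolP/Hi D1 /asboolP/Hi D2 m12.
  exact: diagonal_cell_lt m12 D1 D2.
apply/andP; split; apply: (sub_in_sorted _ sO s_sorted) => m1 m2 O1 O2 /= m12.
  by have [] := H _ _ O1 O2 m12.
by have [] := H _ _ O1 O2 m12.
Qed.

Lemma LIS_expectation_ge n : (0 < N)%N ->
  ((n%:R * (1 - expR (- (c * (h / n%:R) ^+ 2)) ^+ N))%:E <=
    'E_P[fun w => (LIS (perm_of_points (fun i => X i w)))%:R])%E.
Proof.
move=> N0.
have [C [mC PC distC]] := coordinates_distinct M_ge0 f_bounded X_iid.
(* Removing [C] makes the indicators vanish where coordinates coincide, so the pointwise comparison
   with the LIS holds everywhere; no probability is lost. *)
pose A (m : 'I_n) := occupied n m `\` C.
have mA m : measurable (A m).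
  by apply: measurableD => //; exact: measurable_occupied.
apply: le_trans (@expectation_ge_sum_indic _ _ _ P n _ A mA _).
  rewrite mulrC mulr_natr -[X in _ *+ X](card_ord n) -sumr_const -sumEFin.
  apply: lee_sum => m _; apply: le_trans (occupied_ge (ltn_ord m)) _.
  rewrite -[leRHS]adde0 -PC; apply: le_trans (measureU2 _ (mA m) mC).
  apply: le_measure; rewrite ?inE; [|exact: measurableU|].
    exact: measurable_occupied.
  by move=> w Ow; case: (pselect (C w)); [right|left].
move=> w; case: (pselect (C w)) => [Cw|Cw].
  by rewrite big1// => m _; rewrite indicE memNset// => -[].
have [X1 X2] := distC w Cw.
apply: (@le_trans _ _ (#|[pred m : 'I_n | `[< occupied n m w >]]|%:R)).
  rewrite -sum1_card natr_sum [leRHS]big_mkcond /=; apply: ler_sum => m _.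
  rewrite indicE inE /=; case: asboolP => Ow; first by case: (_ \in _).
  by rewrite memNset// => -[].
by rewrite ler_nat LIS_ge_occupied.
Qed.

End LowerBound.

(** * Choice of the grid sizes and comparison with the square root *)

Theorem proposition1p3 (R : realType) (f : R * R -> R)
  (f_continuous : {within unit_square, continuous f})
  (f_density : probability_density f)
  (d : nat -> measure_display) (Omega : forall N, measurableType (d N))
  (P : forall N, probability (Omega N) R)
  (X : forall N, 'I_N -> {RV (P N) >-> plane R})
  (X_iid : forall N, iid_with_law (mu_ f) (X N)) :
  (fun N => fine ('E_(P N)[fun w => (LIS (perm_of_points (fun k => X N k w)))%:R])%E)
    =Theta_\oo (fun N => Num.sqrt N%:R).
Proof.
have [M M1 f_bounded] := density_bounded f_continuous f_density.
have [c [h [a [b [c0 h0 sub f_ge]]]]] :=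
  density_pos_square f_continuous f_density.
have M0 : 0 <= M by apply: le_trans M1.
(* The numerator bounds from below the probability that a cell is occupied when [n <= Num.sqrt N];
   the factor 1/2 comes from [r < n + 1 <= 2 * n]. *)
pose K1 := (1 - expR (- (c * h ^+ 2))) / 2.
have expK : expR (- (c * h ^+ 2)) < 1.
  by rewrite -[ltRHS]expR0 ltr_expR oppr_lt0 mulr_gt0 ?exprn_gt0.
have K10 : 0 < K1 by rewrite divr_gt0 ?subr_gt0.
(* From [k <= Num.sqrt (32 * M) * r + 1] and [N / k <= r], together with [1 <= r]. *)
pose K2 := Num.sqrt (32 * M) + 2.
have K20 : 0 < K2 by rewrite ltr_wpDl ?sqrtr_ge0.
rewrite eqThetaE qualifE; apply/asboolP; exists (K1, K2); rewrite /= ?K10 ?K20//.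
exists 1%N => // N /= N0.
set E := ('E_(P N)[_])%E; set r : R := Num.sqrt N%:R.
have r1 : 1 <= r by rewrite -[leLHS]sqrtr1 ler_sqrt ?ler1n.
have r0 : 0 <= r by apply: le_trans r1.
have rr : r * r = N%:R by rewrite -expr2 sqr_sqrtr.
have lower : ((K1 * r)%:E <= E)%E.
  pose n := Num.truncn r.
  have /andP[nr rn] := truncn_itv r0.
  have n0 : 0 < n%:R :> R by rewrite ltr0n truncn_gt0.
  have n1 : 1 <= n%:R :> R by rewrite ler1n truncn_gt0.
  apply: le_trans (LIS_expectation_ge M0 f_bounded c0 h0 sub f_ge (X_iid N) n N0).
  rewrite lee_fin /K1 mulrAC -mulrA mulrC.
  apply: (@le_trans _ _ (n%:R * (1 - expR (- (c * h ^+ 2))))).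
    rewrite ler_wpM2r ?subr_ge0 ?(ltW expK)// ler_pdivrMr//.
    by move: rn; rewrite -natr1 -/n => rn; lra.
  rewrite ler_wpM2l ?(ltW n0)// lerB// -expRM_natl ler_expR mulrN lerN2.
  have -> : N%:R * (c * (h / n%:R) ^+ 2) = c * h ^+ 2 * (N%:R / n%:R ^+ 2).
    by rewrite expr_div_n; ring.
  rewrite ler_peMr ?mulr_ge0 ?exprn_ge0 ?(ltW c0) ?(ltW h0)//.
  by rewrite ler_pdivlMr ?exprn_gt0// mul1r -rr expr2 ler_pM.
have upper : (E <= (K2 * r)%:E)%E.
  pose k := (Num.truncn (Num.sqrt (32 * M * N%:R))).+1.
  have sk : Num.sqrt (32 * M * N%:R) <= k%:R by apply/ltW/truncnS_gt.
  have MN0 : 0 <= 32 * M * N%:R by rewrite !mulr_ge0.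
  have sE : Num.sqrt (32 * M * N%:R) = Num.sqrt (32 * M) * r.
    by rewrite sqrtrM// mulr_ge0.
  have k0 : (0 < k)%N by [].
  apply: le_trans (LIS_expectation_le M0 f_bounded (X_iid N) k0 _) _.
    by rewrite -[leLHS]sqr_sqrtr// lerXn2r ?nnegrE ?sqrtr_ge0.
  rewrite lee_fin.
  have kr : k%:R <= Num.sqrt (32 * M) * r + 1.
    rewrite -sE /k -[leLHS]natr1 lerD2r.
    by have /andP[] := truncn_itv (sqrtr_ge0 (32 * M * N%:R)).
  have Nk : N%:R / k%:R <= r.
    rewrite ler_pdivrMr ?ltr0n// -rr ler_wpM2l// (le_trans _ sk)// sE.
    by rewrite ler_peMl// -[leLHS]sqrtr1 ler_sqrt//; lra.
  by rewrite /K2; lra.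
(* Finiteness has to be known before passing to [fine], which would send an infinite value to 0. *)
have Efin : E \is a fin_num.
  by rewrite fin_numElt (lt_le_trans _ lower) ?ltNyr// (le_lt_trans upper) ?ltry.
rewrite -(fineK Efin) !lee_fin in lower upper.
rewrite (ger0_norm r0) ger0_norm//.
by apply: le_trans lower; rewrite mulr_ge0// ltW.
Qed.
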